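(* Let $Z\subset\mathbb{P}^2$ be a finite set of points and let $k\ge3$ be an integer. If $\alpha(I(kZ))-\alpha(I(Z))=k-1$, then the points of $Z$ are collinear.
   Context: Work over an algebraically closed field $\mathbb{K}$ of characteristic zero, $R=\mathbb{K}[x_0,x_1,x_2]$. For $Z=\{P_1,\dots,P_r\}\subset\mathbb{P}^2$, $I(P_i)$ is the homogeneous maximal ideal of $P_i$ and $I(kZ)=I(P_1)^k\cap\dots\cap I(P_r)^k$ (the $k$-th symbolic power of $I(Z)=I(1Z)$). For a homogeneous ideal $J$, $\alpha(J)=\min\{n:J_n\ne0\}$ is its initial degree. *)

(* Defs.v *)
From HB Require Import structures.
From mathcomp Require Import all_boot all_order all_algebra.
From mathcomp Require Import mpoly.
Set Implicit Arguments. Unset Strict Implicit. Unset Printing Implicit Defensive.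
Import GRing.Theory.
Local Open Scope ring_scope.

(* R = K[x0,x1,x2] is {mpoly K[3]}; a point of P^2 is given by a nonzero
   representative p : 'I_3 -> K (homogeneous coordinates). *)

Section Defs.
Variable K : fieldType.

Definition point := {ffun 'I_3 -> K}.

(* I(P): the homogeneous ideal of P, i.e. polynomials vanishing on the
   whole line of representatives {lambda * p} (the cone over P). *)
Definition IP (p : point) (f : {mpoly K[3]}) : Prop :=
  forall l : K, f.@[fun i => l * p i] = 0.

Definition ideal_pow (J : {mpoly K[3]} -> Prop) (k : nat) (f : {mpoly K[3]}) : Prop :=
  exists s : seq ({mpoly K[3]} * k.-tuple {mpoly K[3]}),
    (forall x, x \in s -> forall g, g \in tval x.2 -> J g) /\
    f = \sum_(x <- s) x.1 * \prod_(g <- tval x.2) g.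

Definition IkZ (k : nat) (Z : seq point) (f : {mpoly K[3]}) : Prop :=
  forall p, p \in Z -> ideal_pow (IP p) k f.

Definition nonzero_in_degree (J : {mpoly K[3]} -> Prop) (n : nat) : Prop :=
  exists f : {mpoly K[3]}, [/\ f != 0, f \is n.-homog & J f].

Definition is_alpha (J : {mpoly K[3]} -> Prop) (a : nat) : Prop :=
  nonzero_in_degree J a /\ (forall n, nonzero_in_degree J n -> (a <= n)%N).

Definition collinear (Z : seq point) : Prop :=
  exists c : 'I_3 -> K, (exists i, c i != 0) /\
    forall p, p \in Z -> \sum_(i < 3) c i * p i = 0.

End Defs.

(* Main.v *)
Require Import Defs.
From HB Require Import structures.
From mathcomp Require Import all_boot all_order all_algebra.
From mathcomp Require Import perm mpoly ring zify.
Set Implicit Arguments. Unset Strict Implicit. Unset Printing Implicit Defensive.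
Import GRing.Theory.
Local Open Scope ring_scope.

(* Let a = alpha(I(Z)) and let f be a form of degree a + k - 1 in I(kZ).
   Differentiating k - 3 times yields a form of degree a + 2 with multiplicity
   at least 3 at every point of Z. Assume a >= 2.
   This form is squarefree: if it were g h^2 with deg h = e >= 1, then g is
   triple at the points of Z off h, so h times a second derivative of g would
   be a form of degree a - e vanishing on Z (the cases deg g <= 1 are similar).
   Hence f and a generic polar of f have no common component, and Bezout's
   inequality gives 6 |Z| <= (a + 2)(a + 1). On the other hand
   |Z| >= a (a + 1) / 2, since no form of degree a - 1 vanishes on Z; so
   3 a <= a + 2, a contradiction. Thus a <= 1 and Z lies on a line.

   Bezout's inequality is read off the resultant of f and its derivative along
   a generic direction o, in an affine chart u + x v + y o where the points of
   Z have distinct x-coordinates: the resultant is a polynomial in x of degree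
   at most (a + 2)(a + 1), vanishing to order 6 at the abscissa of each point. *)

(** * Bivariate polynomials *)

Section Bivariate.
Variable K : fieldType.
Local Notation P := {poly {poly K}}.
Implicit Types (F G H : P) (p : K * K).

Definition ev p F : K := F.[p.2%:P].[p.1].

(* The outer variable is y, so [F^`()] is the y-derivative. *)
Definition dx F : P := map_poly (@deriv K) F.

(** Multiplicity is tested by the vanishing of all iterated partial derivatives of order less than
    [k], a form suited to inductions by the Leibniz rule. *)
Fixpoint mult_ge (k : nat) p F : Prop :=
  if k is k'.+1 then
    [/\ ev p F = 0, mult_ge k' p (dx F) & mult_ge k' p F^`()]
  else True.

(** Only an upper bound on the total degree; zero satisfies it for every [n]. *)
Definition tdeg (n : nat) F : Prop :=
  forall i j, (n < i + j)%N -> F`_i`_j = 0.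

Lemma evD p F G : ev p (F + G) = ev p F + ev p G.
Proof. by rewrite /ev !hornerD. Qed.

Lemma evM p F G : ev p (F * G) = ev p F * ev p G.
Proof. by rewrite /ev !hornerM. Qed.

Lemma dxD F G : dx (F + G) = dx F + dx G.
Proof. by rewrite /dx raddfD. Qed.

Lemma dxM F G : dx (F * G) = dx F * G + F * dx G.
Proof.
apply/polyP=> n; rewrite coefD coef_map !coefM /= raddf_sum -big_split /=.
by apply: eq_bigr => i _; rewrite derivM !coef_map.
Qed.

Lemma mult_ge0 k p : mult_ge k p 0.
Proof.
by elim: k => //= k IH; split; rewrite ?deriv0 /dx ?raddf0 // /ev !horner0.
Qed.

Lemma mult_geD k p F G : mult_ge k p F -> mult_ge k p G -> mult_ge k p (F + G).
Proof.
elim: k F G => //= k IH F G [f1 f2 f3] [g1 g2 g3].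
split; first by rewrite evD f1 g1 addr0.
- by rewrite dxD; apply: IH.
- by rewrite derivD; apply: IH.
Qed.

Lemma mult_geS k p F : mult_ge k.+1 p F -> mult_ge k p F.
Proof.
elim: k F => // k IH F [f1 f2 f3]; split=> //; exact: IH.
Qed.

Lemma mult_geMl k p F G : mult_ge k p G -> mult_ge k p (F * G).
Proof.
elim: k F G => //= k IH F G [g1 g2 g3].
have Gk : mult_ge k p G by apply: mult_geS; split.
split; first by rewrite evM g1 mulr0.
- by rewrite dxM; apply: mult_geD; apply: IH.
- by rewrite derivM; apply: mult_geD; apply: IH.
Qed.

(** By the Leibniz rule, each partial derivative of the product is a multiple of [G] plus [F] times
    a derivative of [G]; the latter is handled by induction on [k]. *)
Lemma mult_ge_mulS k p F G :
  ev p F = 0 -> mult_ge k p G -> mult_ge k.+1 p (F * G).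
Proof.
elim: k G => [|k IH] G F0 Gk.
  by split=> //; rewrite evM F0 mul0r.
have [_ G2 G3] := Gk.
split; first by rewrite evM F0 mul0r.
- rewrite dxM; apply: mult_geD; first exact: mult_geMl.
  exact: IH.
- rewrite derivM; apply: mult_geD; first exact: mult_geMl.
  exact: IH.
Qed.

(** Induction first gives [G] one order less; then [F * dx G = dx (F * G) - dx F * G] has that order
    too, so [dx G] has it by induction. The y-derivative is treated alike. *)
Lemma mult_ge_unit k p F G :
  ev p F != 0 -> mult_ge k p (F * G) -> mult_ge k p G.
Proof.
move=> F0; have mN H i : mult_ge i p H -> mult_ge i p (- H).
  by rewrite -mulN1r; apply: mult_geMl.
elim: k G => // k IH G FG.
have Gk := IH _ (mult_geS FG).
case: FG => FG1 FG2 FG3; split.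
- by apply/eqP; move/eqP: FG1; rewrite evM mulf_eq0 (negPf F0).
- apply: IH; rewrite (_ : F * _ = dx (F * G) - dx F * G); last first.
    by rewrite dxM addrC addKr.
  by apply: mult_geD => //; apply/mN/mult_geMl.
- apply: IH; rewrite (_ : F * _ = (F * G)^`() - F^`() * G); last first.
    by rewrite derivM addrC addKr.
  by apply: mult_geD => //; apply/mN/mult_geMl.
Qed.

Lemma mult_ge_derivn k m p F : mult_ge (m + k) p F -> mult_ge k p F^`(m).
Proof.
by elim: m F => [|m IH] F; rewrite ?derivSn //= => -[_ _ h]; apply: IH.
Qed.

Lemma tdeg_size n F i : tdeg n F -> (i <= n)%N -> (size (F`_i)%R <= (n - i).+1)%N.
Proof. by move=> tF le_in; apply/leq_sizeP => j hj; apply: tF; lia. Qed.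

Lemma tdeg_coef0 n F i : tdeg n F -> (n < i)%N -> F`_i = 0.
Proof. by move=> tF ni; apply/polyP=> j; rewrite coef0; apply: tF; lia. Qed.

Lemma tdegD n F G : tdeg n F -> tdeg n G -> tdeg n (F + G).
Proof. by move=> tF tG i j ij; rewrite !coefD tF // tG // addr0. Qed.

Lemma tdeg_sum n (I : Type) (r : seq I) (A : pred I) (E : I -> P) :
  (forall i, A i -> tdeg n (E i)) -> tdeg n (\sum_(i <- r | A i) E i).
Proof.
move=> tE; apply: (big_ind (tdeg n)) => //; last exact: tdegD.
by move=> i j _; rewrite !coef0.
Qed.

Lemma tdegC (c : K) : tdeg 0 c%:P%:P.
Proof. by move=> [|i] [|j] //; rewrite coefC /= ?coef0 ?coefC. Qed.

Lemma ev_tdeg0_neq0 p F : tdeg 0 F -> F != 0 -> ev p F != 0.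
Proof.
move=> tF; have -> : F = (F`_0`_0)%:P%:P.
  apply/polyP=> i; apply/polyP=> j; rewrite coefC.
  case: i => [|i] /=; last by rewrite tF // coef0.
  by rewrite coefC; case: j => [|j] //=; rewrite tF.
by rewrite /ev !hornerC !polyC_eq0.
Qed.

Lemma tdegM m n F G : tdeg m F -> tdeg n G -> tdeg (m + n) (F * G).
Proof.
move=> tF tG i j ij; rewrite coefM coef_sum big1 // => k _.
rewrite coefM big1 // => l _; case: (ltnP m (k + l)) => [h|h].
  by rewrite tF // mul0r.
by rewrite (tG (i - k)%N) ?mulr0 //; have := ltn_ord k; have := ltn_ord l; lia.
Qed.

Lemma tdeg_coefM m n F G :
  tdeg m F -> tdeg n G -> (F * G)`_(m + n) = F`_m * G`_n.
Proof.
move=> tF tG; have hm : (m < (m + n).+1)%N by lia.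
rewrite coefM (bigD1 (Ordinal hm)) //= addKn big1 ?addr0 // => i.
rewrite -val_eqE /= => ni; case: (ltnP m i) => h.
  by rewrite (tdeg_coef0 tF) // mul0r.
by rewrite (tdeg_coef0 tG) ?mulr0 //; lia.
Qed.

Lemma tdeg_deriv n F : tdeg n F -> tdeg n.-1 F^`().
Proof.
by move=> tF i j ij; rewrite coef_deriv coefMn tF ?mul0rn //; lia.
Qed.

Lemma tdeg_derivn n m F : tdeg n F -> tdeg (n - m) F^`(m).
Proof.
elim: m => [|m IH] tF; first by rewrite subn0.
by rewrite derivnS subnS; apply/tdeg_deriv/IH.
Qed.

(* The exact total degree, together with the least y-exponent occurring in
   the top form. *)
Lemma tdeg_top F : F != 0 -> exists n i, [/\ (i <= n)%N, F`_i`_(n - i) != 0,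
  tdeg n F & forall k l, (k < i)%N -> (k + l = n)%N -> F`_k`_l = 0].
Proof.
move=> F0; pose N := (\max_(i < size F) size (F`_i)%R)%N.
pose top n := [exists i : 'I_(size F), (i <= n)%N && (F`_i`_(n - i) != 0)].
have in_top i j : F`_i`_j != 0 -> top (i + j)%N.
  move=> h; have hi : (i < size F)%N.
    by rewrite ltnNge; apply: contra h => h; rewrite (nth_default 0 h) coef0.
  by apply/existsP; exists (Ordinal hi); rewrite /= leq_addr addKn.
have ub n : top n -> (n <= size F + N)%N.
  case/existsP=> i /andP[le_in h].
  have : (n - i < size (F`_i)%R)%N.
    by rewrite ltnNge; apply: contra h => h; rewrite (nth_default 0 h).
  have : (size (F`_i)%R <= N)%N by apply: (leq_bigmax i).
  by have := ltn_ord i; lia.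
have ex : exists n, top n.
  exists ((size F).-1 + (size (lead_coef F)).-1)%N; apply: in_top.
  by rewrite -lead_coefE -lead_coefE !lead_coef_eq0.
case: (ex_maxnP ex ub) => n topn maxn.
pose low i := (i <= n)%N && (F`_i`_(n - i) != 0).
have exl : exists i, low i by case/existsP: topn => i hi; exists i.
case: (ex_minnP exl) => i /andP[le_in h] mini.
exists n, i; split=> //.
- move=> k l nkl; apply/eqP; apply: contraLR nkl => /in_top /maxn.
  by rewrite -leqNgt.
- move=> k l ki kl; apply/eqP; apply: contraLR ki => nz.
  rewrite -leqNgt; apply: mini; rewrite /low -kl leq_addr addKn.
  exact: nz.
Qed.

(* Top forms of F and G multiply to a nonzero form, as seen on the coefficient
   of least y-exponent. *)
Lemma tdeg_mul_regular F G : tdeg (size (F * G)).-1 (F * G) -> F * G != 0 ->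
  tdeg (size F).-1 F /\ tdeg (size G).-1 G.
Proof.
move=> tFG FG0; have [F0 G0] : F != 0 /\ G != 0.
  by apply/andP; rewrite -negb_or -mulf_eq0.
have [m [i [im nzF tF lowF]]] := tdeg_top F0.
have [n [j [jn nzG tG lowG]]] := tdeg_top G0.
have le_size (A : P) N : A != 0 -> tdeg N A -> ((size A).-1 <= N)%N.
  move=> A0 tA; rewrite leqNgt; apply/negP => h.
  by move: A0; rewrite -lead_coef_eq0 lead_coefE (tdeg_coef0 tA h) eqxx.
have nzFG : (F * G)`_(i + j)`_(m - i + (n - j)) != 0.
  have hi : (i < (i + j).+1)%N by lia.
  have hm : (m - i < (m - i + (n - j)).+1)%N by lia.
  rewrite coefM coef_sum (bigD1 (Ordinal hi)) //= [X in _ + X]big1 ?addr0.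
    rewrite coefM (bigD1 (Ordinal hm)) //= [X in _ + X]big1 ?addr0.
      by rewrite !addKn mulf_neq0.
    move=> l; rewrite -val_eqE /= => nl; case: (ltnP (m - i) l) => h.
      by rewrite tF ?mul0r //; lia.
    by rewrite addKn tG ?mulr0 //; have := ltn_ord l; lia.
  move=> k; rewrite -val_eqE /= => nk; rewrite coefM big1 // => l _.
  have hl := ltn_ord l; have hk := ltn_ord k.
  case: (ltnP m (k + l)) => h; first by rewrite tF ?mul0r.
  case: (ltnP k i) => ki.
    case: (ltngtP (k + l) m) => h2; last by rewrite lowF ?mul0r.
      by rewrite (tG (i + j - k)%N) ?mulr0 //; lia.
    by lia.
  case: (ltngtP (k + l) m) => h2; last by rewrite (lowG (i + j - k)%N) ?mulr0 //; lia.
    by rewrite (tG (i + j - k)%N) ?mulr0 //; lia.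
  by lia.
(* The y-degrees of [F] and [G] are at most [m] and [n], and their sum is the y-degree of the
   product, which is at least [m + n]; so both are equalities. *)
have mn : (m + n <= (size (F * G)%R).-1)%N.
  rewrite leqNgt; apply/negP => h; move/eqP: nzFG; apply; apply: tFG; lia.
have := le_size _ _ F0 tF; have := le_size _ _ G0 tG.
have sF : (0 < size F)%N by rewrite size_poly_gt0.
have sG : (0 < size G)%N by rewrite size_poly_gt0.
have sFG : size (F * G) = (size F + size G).-1 by apply: size_mul.
rewrite sFG in mn => h1 h2.
have -> : (size F).-1 = m by lia.
by have -> : (size G).-1 = n by lia.
Qed.

End Bivariate.

(** * Degree and order of vanishing of resultants *)

Section Determinants.
Variable K : fieldType.

(** Entry (i, j) has degree at most [al i - be j], so all nonzero terms of the Leibniz expansion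
    obey the same bound. *)
Lemma size_det_weight n (A : 'M[{poly K}]_n) (al be : 'I_n -> nat) :
  (forall i j, A i j != 0 -> (size (A i j) + be j <= (al i).+1)%N) ->
  (size (\det A) <= (\sum_i al i - \sum_j be j).+1)%N.
Proof.
move=> hA; apply: (leq_trans (size_sum _ _ _)); apply/bigmax_leqP => s _.
rewrite size_Msign; set t := \prod_i _.
have [/forallP nz | /forallPn [i]] := boolP [forall i, A i (s i) != 0]; last first.
  by rewrite negbK /t => /eqP Ai0; rewrite (bigD1 i) //= Ai0 mul0r size_poly0.
apply: (leq_trans (size_poly_prod_leq _ _)); rewrite cardT size_enum_ord.
have : (\sum_i (size (A i (s i)) + be (s i)) <= \sum_i (al i + 1))%N.
  by apply: leq_sum => i _; rewrite addn1; apply: hA.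
rewrite !big_split /= sum_nat_const card_ord muln1.
have -> : (\sum_i be (s i) = \sum_i be i)%N.
  by rewrite [RHS](reindex_inj (@perm_inj _ s)).
have arith (x y z k : nat) : (x + y <= z + k -> x.+1 - k <= (z - y).+1)%N by lia.
exact: arith.
Qed.

(** Truncated subtraction can only increase the sum of the [w i - v (s i)], so every Leibniz term is
    divisible by the stated power. *)
Lemma dvdp_det_weight n (A : 'M[{poly K}]_n) (w v : 'I_n -> nat) (q : {poly K}) :
  (forall i j, q ^+ (w i - v j) %| A i j) ->
  q ^+ (\sum_i w i - \sum_j v j) %| \det A.
Proof.
move=> hA; rewrite /determinant.
apply: (big_ind (fun r => q ^+ (\sum_i w i - \sum_j v j) %| r)) => [| |s _].
- exact: dvdp0.
- by move=> x y; apply: dvdp_add.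
apply: dvdp_mull; apply: (@dvdp_trans _ (\prod_i q ^+ (w i - v (s i)))).
  rewrite -expr_sum; apply: dvdp_exp2l.
  rewrite leq_subLR [X in (_ <= X + _)%N](reindex_inj (@perm_inj _ s)).
  rewrite -big_split /=.
  by apply: leq_sum => i _; lia.
by apply: (big_ind2 (fun a b => a %| b)) => // *; apply: dvdp_mul.
Qed.

End Determinants.

(** * Sylvester determinants and translation of the variable *)

Section Sylvester.
Variable R : idomainType.
Implicit Types p q : {poly R}.

Local Notation band r := (lin1_mx (poly_rV \o r \o* rVpoly)).

(* [Sylvester_mx] with its dimensions as parameters; [m] and [n] bound the
   degrees of [q] and [p]. *)
Definition sylvester m n p q : 'M[R]_(m + n) := col_mx (band p) (band q).

Lemma sylvesterE m n p q (i j : 'I_(m + n)) :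
  sylvester m n p q i j =
  match split i with
  | inl k => p`_(j - k) *+ (k <= j)
  | inr k => q`_(j - k) *+ (k <= j)
  end.
Proof.
rewrite mxE; case: {i}(split i) => i; rewrite !mxE /=;
  by rewrite rVpoly_delta coefXnM ltnNge if_neg -mulrb.
Qed.

Let shift_mx (c : R) d : 'M[R]_d :=
  lin1_mx (poly_rV \o comp_poly ('X + c%:P) \o rVpoly).

Let size_shift c p : size (p \Po ('X + c%:P)) = size p.
Proof. by rewrite size_comp_poly2 // size_XaddC. Qed.

Let det_shift c d : \det (shift_mx c d) = 1.
Proof.
have E (i j : 'I_d) : shift_mx c d i j = (('X + c%:P) ^+ i)`_j.
  by rewrite !mxE /= rVpoly_delta comp_Xn_poly.
rewrite det_trig; last first.
  apply/is_trig_mxP => i j ij; rewrite E nth_default //.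
  by rewrite -comp_Xn_poly size_shift size_polyXn.
rewrite big1 // => i _; rewrite E.
have := monic_exp i (monicXaddC c); rewrite monicE lead_coefE.
by rewrite -comp_Xn_poly size_shift size_polyXn => /eqP.
Qed.

Let band_shift c m N p : (size p <= (N - m).+1)%N -> (m <= N)%N ->
  (band p : 'M_(m, N)) *m shift_mx c N =
  shift_mx c m *m (band (p \Po ('X + c%:P)) : 'M_(m, N)).
Proof.
move=> sp mN; apply/row_matrixP => i; rewrite !rowE !mulmxA !mul_rV_lin1 /=.
rewrite rVpoly_delta poly_rV_K ?[in RHS]poly_rV_K ?size_shift ?size_polyXn //.
  by rewrite comp_polyM.
by apply: leq_trans (size_polyMleq _ _) _; rewrite size_polyXn; have := ltn_ord i; lia.
Qed.

(** Translation is a ring morphism, so it intertwines the two Sylvester matrices through matrices of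
    [X -> X + c] on polynomials of bounded degree. These are unitriangular. *)
Lemma det_sylvester_shift c m n p q :
  (size p <= n.+1)%N -> (size q <= m.+1)%N ->
  \det (sylvester m n (p \Po ('X + c%:P)) (q \Po ('X + c%:P))) =
  \det (sylvester m n p q).
Proof.
move=> sp sq; have : sylvester m n p q *m shift_mx c (m + n) =
    block_mx (shift_mx c m) 0 0 (shift_mx c n) *m
    sylvester m n (p \Po ('X + c%:P)) (q \Po ('X + c%:P)).
  rewrite mul_col_mx mul_block_col !mul0mx add0r addr0.
  by congr col_mx; apply: band_shift; rewrite ?addKn ?addnK ?leq_addr ?leq_addl.
move/(congr1 determinant).
by rewrite !det_mulmx det_ublock !det_shift !mul1r mulr1.
Qed.

End Sylvester.

(** * Local and global bounds on the resultant *)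

Section Bezout.
Variable K : fieldType.
Hypothesis char0 : [pchar K] =i pred0.
Local Notation P := {poly {poly K}}.
Implicit Types (F G : P) (p : K * K).

Let natK_eq0 n : (n%:R == 0 :> K) = (n == 0%N).
Proof. by move/pcharf0P: char0. Qed.

(** In characteristic zero, differentiation lowers the multiplicity of a root by exactly one. *)
Lemma dvdp_XsubC_deriv (g : {poly K}) (a : K) k :
  root g a -> ('X - a%:P) ^+ k %| g^`() -> ('X - a%:P) ^+ k.+1 %| g.
Proof.
move=> ga; have [-> | g0] := eqVneq g 0; first by rewrite dvdp0.
have [[|m] [q]] := multiplicity_XsubC g a; rewrite g0 /= => qa Eg.
  by move: ga; rewrite Eg mulr1 (negPf qa).
have [km _ | mk] := leqP k m.
  by rewrite Eg; apply/dvdp_mull/dvdp_exp2l.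
rewrite Eg derivM deriv_exp derivXsubC mul1r /=.
move/(dvdp_trans (dvdp_exp2l _ mk)); rewrite dvdp_addr; last exact: dvdp_mull.
rewrite mulrnAr -mulrnAl exprS dvdp_mul2r ?expf_neq0 ?polyXsubC_eq0 //.
rewrite dvdp_XsubCl rootE hornerMn -mulr_natl mulf_eq0 -[_.[a] == 0]/(root q a).
by rewrite (negPf qa) natK_eq0.
Qed.

Lemma deriv_horner_const F (c : K) : (F.[c%:P])^`() = (dx F).[c%:P].
Proof.
elim/poly_ind: F => [|F a IH]; first by rewrite /dx raddf0 !horner0 deriv0.
have -> : dx (F * 'X + a%:P) = dx F * 'X + a^`()%:P.
  apply/polyP=> i; rewrite coef_map /= !coefD !coefMX coef_map /= !coefC derivD.
  by case: i => //= [|i]; rewrite deriv0.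
by rewrite !hornerMXaddC derivD derivM derivC mulr0 addr0 IH.
Qed.

Lemma dvdp_mult_ge k p F :
  mult_ge k p F -> ('X - p.1%:P) ^+ k %| F.[p.2%:P].
Proof.
elim: k F => [|k IH] F; first by rewrite dvd1p.
case=> F0 Fx _; apply: dvdp_XsubC_deriv; first exact/eqP.
by rewrite deriv_horner_const; apply: IH.
Qed.

Lemma coef_shift F (c : {poly K}) i :
  (F \Po ('X + c%:P))`_i *+ i`! = F^`(i).[c].
Proof.
have -> : F^`(i).[c] = (F \Po ('X + c%:P))^`(i).[0].
  have -> : (F \Po ('X + c%:P))^`(i) = F^`(i) \Po ('X + c%:P).
    elim: i => // i IH; rewrite !derivnS IH deriv_comp derivD derivX derivC.
    by rewrite addr0 mulr1.
  by rewrite horner_comp hornerD hornerX hornerC add0r.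
by rewrite horner_coef0 coef_derivn addn0 ffactnn.
Qed.

(** Up to the invertible factor [i!], this Taylor coefficient is the i-th y-derivative restricted to
    the horizontal line through [p]. *)
Lemma dvdp_coef_shift m p F i : mult_ge m p F ->
  ('X - p.1%:P) ^+ (m - i) %| (F \Po ('X + p.2%:P%:P))`_i.
Proof.
move=> mF; have [im|mi] := leqP i m; last first.
  by rewrite (eqP (ltnW mi)) dvd1p.
have : mult_ge (m - i) p F^`(i) by apply: mult_ge_derivn; rewrite subnKC.
move/dvdp_mult_ge; rewrite -coef_shift -scaler_nat dvdpZr //.
by rewrite natK_eq0 -lt0n fact_gt0.
Qed.

(** The i-th term falls short of [m + n] by [n - i], and these deficits sum to the binomial
    coefficient. *)
Lemma sum_minn e m n : (n <= e)%N ->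
  (\sum_(i < e) minn (m + i) (m + n) + 'C(n.+1, 2) = e * (m + n))%N.
Proof.
move=> ne; have -> : 'C(n.+1, 2) = (\sum_(i < e) (n - i))%N.
  elim: e n ne => [|e IH] [|n] //; rewrite ?big_ord0 //.
    by move=> _; rewrite big1.
  move=> ne; rewrite big_ord_recl subn0 binS bin1 (IH n) // addnC.
  by congr (_ + _)%N; apply: eq_bigr => i _; rewrite subSS.
rewrite -big_split /= -[e in RHS]card_ord -sum_nat_const.
by apply: eq_bigr => i _; lia.
Qed.

Lemma bin2D m n : ('C((m + n).+1, 2) = 'C(m.+1, 2) + 'C(n.+1, 2) + m * n)%N.
Proof.
elim: n => [|n IH]; first by rewrite addn0 muln0 !addn0.
by rewrite addnS binS bin1 IH [in RHS](binS n.+1) bin1; lia.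
Qed.

(* The weights are truncated at [m + n] so that columns beyond the [m + n]
   first ones contribute nothing. *)
Lemma dvdp_det_sylvester d e m n p F G :
  (size F <= d.+1)%N -> (size G <= e.+1)%N -> (m <= d)%N -> (n <= e)%N ->
  mult_ge m p F -> mult_ge n p G ->
  ('X - p.1%:P) ^+ (m * n) %| \det (sylvester e d F G).
Proof.
move=> sF sG md ne mF mG; rewrite -(det_sylvester_shift p.2%:P) //.
set A := sylvester _ _ _ _.
(* In the band of [F], the entry of row k and column j is the Taylor coefficient of index j - k,
   divisible to the order m - (j - k) = (m + k) - j. The band of [G] has [n] for [m]. *)
pose w (i : 'I_(e + d)) := match split i with
  | inl k => minn (m + k) (m + n) | inr k => minn (n + k) (n + m) end.
pose v (j : 'I_(e + d)) := minn (0 + j) (0 + (m + n)).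
have := @dvdp_det_weight _ _ A w v ('X - p.1%:P).
(* The terms [e * (m + n)] and [d * (m + n)] cancel; what remains is the difference of binomials
   evaluated by [bin2D]. *)
have -> : (\sum_i w i - \sum_j v j = m * n)%N.
  have Sl : (\sum_(i < e) w (lshift d i) = \sum_(i < e) minn (m + i) (m + n))%N.
    by apply: eq_bigr => i _; rewrite /w (unsplitK (inl i)).
  have Sr : (\sum_(i < d) w (rshift e i) = \sum_(i < d) minn (n + i) (n + m))%N.
    by apply: eq_bigr => i _; rewrite /w (unsplitK (inr i)).
  rewrite [X in (X - _)%N]big_split_ord /= Sl Sr /v.
  have := sum_minn m ne; have := sum_minn n md.
  have := sum_minn 0 (leq_add md ne); rewrite bin2D [(e + d)%N]addnC.
  move: (\sum_(i < d + e) _)%N (\sum_(i < d) _)%N (\sum_(i < e) _)%N => x y z.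
  by rewrite !add0n !mulnDl !mulnDr; lia.
apply=> i j; rewrite /A sylvesterE /w /v; case: (split i) => k.
  case: (leqP k j) => kj; last by rewrite dvdp0.
  apply: dvdp_trans (dvdp_coef_shift (j - k) mF); apply: dvdp_exp2l; lia.
case: (leqP k j) => kj; last by rewrite dvdp0.
apply: dvdp_trans (dvdp_coef_shift (j - k) mG); apply: dvdp_exp2l; lia.
Qed.

(** In the band of [F], the entry (k, j) has degree at most d - (j - k) = (d + k) - j, and similarly
    for [G]; the weights sum to 2de - de. *)
Lemma size_det_sylvester d e F G : tdeg d F -> tdeg e G ->
  (size (\det (sylvester e d F G)) <= (d * e).+1)%N.
Proof.
move=> tF tG.
pose al (i : 'I_(e + d)) := match split i with
  | inl k => (d + k)%N | inr k => (e + k)%N end.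
have arith (x D i j : nat) : (i <= j -> j - i <= D -> x <= (D - (j - i)).+1 ->
  x + j <= (D + i).+1)%N by lia.
apply: leq_trans (size_det_weight (al := al) (be := fun j => val j) _) _.
  move=> i j; rewrite sylvesterE /al; case: (split i) => k.
    case: (leqP k j) => kj; last by rewrite eqxx.
    case: (leqP (j - k) d) => h; last by rewrite (tdeg_coef0 tF) ?mul0rn ?eqxx.
    by move=> _; apply: arith => //; apply: tdeg_size.
  case: (leqP k j) => kj; last by rewrite eqxx.
  case: (leqP (j - k) e) => h; last by rewrite (tdeg_coef0 tG) ?mul0rn ?eqxx.
  by move=> _; apply: arith => //; apply: tdeg_size.
have Sl : (\sum_(i < e) al (lshift d i) = \sum_(i < e) (d + i))%N.
  by apply: eq_bigr => i _; rewrite /al (unsplitK (inl i)).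
have Sr : (\sum_(i < d) al (rshift e i) = \sum_(i < d) (e + i))%N.
  by apply: eq_bigr => i _; rewrite /al (unsplitK (inr i)).
rewrite ltnS leq_subLR [X in (X <= _)%N]big_split_ord /= Sl Sr.
rewrite [(\sum_(j < e + d) j)%N]big_split_ord /= !big_split /=.
rewrite !sum_nat_const !card_ord; lia.
Qed.

End Bezout.

Lemma prod_XsubC_exp_dvdp (K : fieldType) (s : seq K) k (q : {poly K}) : uniq s ->
  (forall a, a \in s -> ('X - a%:P) ^+ k %| q) ->
  (\prod_(a <- s) ('X - a%:P)) ^+ k %| q.
Proof.
elim: s => [|a s IH] /=; first by rewrite big_nil expr1n dvd1p.
case/andP=> a_s us hq; rewrite big_cons exprMn Gauss_dvdp.
  rewrite hq ?mem_head //=; apply: IH => // b bs.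
  by apply: hq; rewrite inE bs orbT.
apply/coprimep_expl/coprimep_expr; rewrite coprimep_sym coprimep_XsubC.
by rewrite root_prod_XsubC.
Qed.

(** * Curves through few points *)

Section Interpolation.
Variable K : fieldType.
Local Notation P := {poly {poly K}}.

Lemma card_monomials n :
  #|[pred ij : 'I_n * 'I_n | (ij.1 + ij.2 < n)%N]| = 'C(n.+1, 2).
Proof.
rewrite -sum1_card; under eq_bigl => ij do rewrite inE.
rewrite -(pair_big_dep xpredT (fun i j : 'I_n => (i + j < n)%N) (fun _ _ => 1%N)) /=.
transitivity (\sum_(i < n) (n - i))%N.
  apply: eq_bigr => i _; rewrite sum1_card.
  rewrite -[RHS]card_ord -(card_image (f := widen_ord (leq_subr i n))).
    apply: eq_card => j; apply/idP/imageP => [|[k _ ->]].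
      rewrite unfold_in => h; have hj : (j < n - i)%N by lia.
      by exists (Ordinal hj) => //; apply: val_inj.
    by rewrite unfold_in /=; have := ltn_ord k; lia.
  by move=> x y /(congr1 val) /= /val_inj.
elim: n => [|n IH]; first by rewrite big_ord0.
rewrite big_ord_recl subn0 binS bin1 -IH addnC; congr addn.
Qed.

Lemma exists_vanishing (Z : seq (K * K)) n : (size Z < 'C(n.+1, 2))%N ->
  exists F : P, [/\ F != 0, tdeg n.-1 F & forall p, p \in Z -> ev p F = 0].
Proof.
rewrite -card_monomials; set T := [pred ij | _] => ZT.
pose mon (k : 'I_#|T|) : 'I_n * 'I_n := enum_val k.
have monP k : ((mon k).1 + (mon k).2 < n)%N by have := enum_valP k.
pose A : 'M[K]_(#|T|, size Z) :=
  \matrix_(k, z) ((tnth (in_tuple Z) z).2 ^+ (mon k).1 *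
                  (tnth (in_tuple Z) z).1 ^+ (mon k).2).
have : kermx A != 0.
  rewrite kermx_eq0 /row_free neq_ltn; apply/orP; left.
  by apply: leq_ltn_trans ZT; apply: rank_leq_col.
case/rowV0Pn => v /sub_kermxP vA v0.
pose F : P := \sum_k (v 0 k *: 'X^((mon k).2)) *: 'X^((mon k).1).
have coefF k : F`_((mon k).1)`_((mon k).2) = v 0 k.
  rewrite !coef_sum (bigD1 k) //= !coefZ !coefXn !eqxx mulr1 coefZ coefXn eqxx.
  rewrite mulr1 big1 ?addr0 // => l lk; rewrite !coefZ !coefXn.
  case: eqP => [e1|_]; last by rewrite mulr0 coef0.
  rewrite mulr1 coefZ coefXn; case: eqP => [e2|_]; last by rewrite mulr0.
  case/eqP: lk; apply: enum_val_inj; rewrite -/(mon l) -/(mon k).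
  by case: (mon l) (mon k) e1 e2 => [x y] [x' y'] /= /val_inj -> /val_inj ->.
exists F; split.
- apply: contraNneq v0 => F0; apply/eqP/rowP => k.
  by rewrite -coefF F0 !coef0 mxE.
- apply: tdeg_sum => k _ i j ij; rewrite !coefZ !coefXn.
  case: eqP => [e1|_]; last by rewrite mulr0 coef0.
  rewrite mulr1 coefZ coefXn; case: eqP => [e2|_]; last by rewrite mulr0.
  by have := monP k; lia.
- move=> p pZ; have hz : (index p Z < size Z)%N by rewrite index_mem.
  have := congr1 (fun M : 'rV_(size Z) => M 0 (Ordinal hz)) vA; rewrite !mxE => <-.
  rewrite /ev /F !horner_sum; apply: eq_bigr => k _.
  rewrite mxE (tnth_nth p) /= nth_index //.
  rewrite hornerZ hornerXn hornerM hornerZ hornerXn -polyC_exp hornerC -mulrA.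
  by congr (_ * _); rewrite mulrC.
Qed.

End Interpolation.

(** * Repeated factors over K[x] *)

Section Gauss.
Variable K : closedFieldType.
Hypothesis char0 : [pchar K] =i pred0.
Local Notation P := {poly {poly K}}.
Implicit Types (F G H : P) (c : {poly K}).

Let natK_eq0 n : (n%:R == 0 :> K) = (n == 0%N).
Proof. by move/pcharf0P: char0. Qed.

Lemma derivn_neq0 m F : (m < size F)%N -> F^`(m) != 0.
Proof.
move=> mF; apply/eqP => /polyP /(_ ((size F).-1 - m)%N).
have -> : F^`(m)`_((size F).-1 - m) = lead_coef F *+ (size F).-1 ^_ m.
  by rewrite coef_derivn subnKC //; lia.
have F0 : F != 0 by rewrite -size_poly_gt0; lia.
rewrite coef0 -scaler_nat => /eqP; rewrite scaler_eq0 natK_eq0 lead_coef_eq0.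
by rewrite (negPf F0) orbF -leqn0 leqNgt ffact_gt0; lia.
Qed.

Lemma root_coefs_factor F (a : K) : map_poly (horner_eval a) F = 0 ->
  exists F', F = ('X - a%:P) *: F'.
Proof.
move=> Fa; exists (map_poly (fun q => q %/ ('X - a%:P)) F).
apply/polyP=> i; rewrite coefZ coef_map_id0 ?div0p // mulrC divpK //.
by rewrite dvdp_XsubCl; move/polyP/(_ i): Fa; rewrite coef_map coef0 /= => /eqP.
Qed.

(* Primes of K[x] are linear, and reduction modulo [x - a] is evaluation at
   [a], with values in the domain K[y]. *)
Lemma gauss_square c F G H : c != 0 -> c *: F = G * H ^+ 2 ->
  exists G' H', F = G' * H' ^+ 2 /\ size H' = size H.
Proof.
have [n] := ubnP (size c); elim: n c G H => // n IH c G H cn c0 E.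
have [c1|] := boolP (size c == 1).
  have [k k0 Ec] := size_poly1P _ c1.
  exists (k^-1%:P *: G), H; split=> //.
  by rewrite -scalerAl -E Ec scalerA -polyCM mulVf // scale1r.
case/closed_rootP => a /factor_theorem [c' Ec].
have c'0 : c' != 0 by apply: contraNneq c0 => c'0; rewrite Ec c'0 mul0r.
have X0 : 'X - a%:P != 0 by rewrite polyXsubC_eq0.
have c'n : (size c' < n)%N.
  by move: cn; rewrite Ec size_Mmonic ?monicXsubC // size_XsubC addn2.
have : map_poly (horner_eval a) G * map_poly (horner_eval a) H ^+ 2 = 0.
  rewrite -rmorphXn -rmorphM /= -E Ec; apply/polyP => i.
  rewrite coef_map coefZ /= /horner_eval !hornerM hornerXsubC subrr.
  by rewrite mulr0 mul0r coef0.
have scalerX0 (A B : P) : ('X - a%:P) *: A = ('X - a%:P) *: B -> A = B.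
  by rewrite -!mul_polyC; apply: mulfI; rewrite polyC_eq0.
move/eqP; rewrite mulf_eq0 expf_eq0 /= => /orP[] /eqP /root_coefs_factor [Q EQ].
  apply: (IH c' Q H) => //; apply: scalerX0.
  by rewrite scalerA [_ * c']mulrC -Ec E EQ scalerAl.
(* Here x - a divides [H], so it occurs twice on the right: one copy is cancelled against [c], the
   other is moved into [G]. *)
have [|G' [H' [E' sH']]] := IH c' (('X - a%:P) *: G) Q c'n c'0.
  apply: scalerX0; rewrite scalerA [_ * c']mulrC -Ec E EQ exprZn.
  by rewrite -scalerAr -scalerAl scalerA expr2.
by exists G', H'; rewrite E' sH' EQ size_scale.
Qed.

(** A nonconstant common divisor [H] of [F] and its derivative that is coprime to its own derivative
    must divide [F] twice, up to a scalar of K[x] that [gauss_square] removes. *)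
Lemma square_factor F : (1 < size (gcdp F F^`()))%N ->
  exists G H, F = G * H ^+ 2 /\ (1 < size H)%N.
Proof.
move=> g1; have [H [sH HF HF' cH]] : exists H, [/\ (1 < size H)%N, H %| F,
    H %| F^`() & coprimep H H^`()].
  have := dvdp_gcdr F F^`(); have := dvdp_gcdl F F^`().
  move: (gcdp _ _) g1 => H; have [n] := ubnP (size H).
  elim: n H => // n IH H Hn sH HF HF'.
  have [cH|ncH] := boolP (coprimep H H^`()); first by exists H.
  have H0 : H != 0 by rewrite -size_poly_gt0; lia.
  have H'0 : H^`() != 0 by apply: (@derivn_neq0 1).
  have dH := lt_size_deriv H0.
  have dG := dvdp_leq H'0 (dvdp_gcdr H H^`()).
  (* Replacing [H] by its gcd with its derivative lowers the y-degree and keeps it positive, so the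
     descent ends at a coprime pair. *)
  apply: (IH (gcdp H H^`())).
  - by apply: leq_ltn_trans dG _; apply: leq_trans dH _.
  - rewrite ltn_neqAle eq_sym size_poly_gt0 gcdp_eq0 (negPf H0) andbT.
    by move: ncH; rewrite coprimep_def.
  - exact: dvdp_trans (dvdp_gcdl _ _) HF.
  - exact: dvdp_trans (dvdp_gcdl _ _) HF'.
have [[c Q] /= c0 E] := Pdiv.Idomain.dvdpP _ _ HF.
have : H %| Q * H^`().
  rewrite -(dvdp_addr _ (dvdp_mull Q^`() (dvdpp H))) -derivM -E derivZ.
  by apply: dvdp_trans HF' _; rewrite dvdpZr.
rewrite Gauss_dvdpl // => /Pdiv.Idomain.dvdpP [[b G] /= b0 EQ].
have := @gauss_square (b * c) F G H; rewrite mulf_neq0 //.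
case=> // [|G' [H' [-> s]]]; last by exists G', H'; rewrite s.
by rewrite -scalerA E scalerAl EQ -mulrA.
Qed.

End Gauss.

(** * Plane curves with triple points *)

Section TriplePoints.
Variable K : closedFieldType.
Hypothesis char0 : [pchar K] =i pred0.
Variables (Z : seq (K * K)) (a : nat).
Hypothesis a_min : forall (G : {poly {poly K}}) n, tdeg n G -> G != 0 ->
  (forall p, p \in Z -> ev p G = 0) -> (a <= n)%N.
Variable F : {poly {poly K}}.
(** Together: y-degree and total degree of [F] coincide, a property inherited by its factors through
    [tdeg_mul_regular]. *)
Hypotheses (tF : tdeg (a + 2) F) (sF : size F = (a + 3)%N).
Hypothesis mF : forall p, p \in Z -> mult_ge 3 p F.

Lemma triple_squarefree G H : (2 <= a)%N -> F = G * H ^+ 2 ->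
  (1 < size H)%N -> False.
Proof.
move=> a2 E sH.
have F0 : F != 0 by rewrite -size_poly_gt0 sF addn3.
have [G0 H0] : G != 0 /\ H != 0.
  by apply/andP; move: F0; rewrite E mulf_eq0 negb_or expf_eq0.
have [g sG] : exists g, size G = g.+1.
  by exists (size G).-1; rewrite prednK ?size_poly_gt0.
have [e sH'] : exists e, size H = e.+1.
  by exists (size H).-1; rewrite prednK ?size_poly_gt0.
have sHH : size (H ^+ 2) = (e + e).+1.
  by rewrite expr2 size_mul // sH' addSn addnS.
have dE : (a + 2 = g + (e + e))%N.
  by move: sF; rewrite E size_mul ?expf_neq0 // sG sHH; lia.
have [tG tHH] : tdeg g G /\ tdeg (e + e) (H ^+ 2).
  have := @tdeg_mul_regular _ G (H ^+ 2); rewrite -E sF sG sHH => h.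
  by apply: h => //; rewrite addn3 /= -addn2.
have [tH _] : tdeg e H /\ tdeg e H.
  have := @tdeg_mul_regular _ H H; rewrite -expr2 sHH sH'; apply=> //.
  by rewrite expf_neq0.
rewrite sH' in sH.
have mG p : p \in Z -> ev p H != 0 -> mult_ge 3 p G.
  move=> pZ Hp; apply: (@mult_ge_unit _ _ _ (H ^+ 2)).
    by rewrite expr2 evM mulf_neq0.
  by rewrite mulrC -E; apply: mF.
have [g2|g1] := leqP 2 g.
  (* The product of [H] and this derivative vanishes on [Z] and has degree at most e + (g - 2) = a -
     e, less than [a]. *)
  have G2 : G^`(2) != 0 by apply: derivn_neq0 => //; rewrite sG.
  have := a_min (tdegM tH (tdeg_derivn (m := 2) tG)).
  rewrite mulf_neq0 // => /(_ isT) h.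
  suff : (a <= e + (g - 2))%N by lia.
  apply: h => p pZ; rewrite evM; have [->|Hp] := eqVneq (ev p H) 0.
    by rewrite mul0r.
  by have [_ _ [_ _ [-> _ _]]] := mG p pZ Hp; rewrite mulr0.
(* Off [H], a triple point of [G] would kill its g-th derivative, a nonzero constant since [g] is at
   most 1. *)
have HZ p : p \in Z -> ev p H = 0.
  move=> pZ; apply/eqP/negPn/negP => Hp.
  have mGp := mG p pZ Hp.
  have : ev p G^`(g) = 0.
    case: (g) g1 => [|[|//]] _; first by have [] := mGp.
    by have [_ _ []] := mGp.
  have tGg : tdeg 0 G^`(g) by rewrite -(subnn g); apply: tdeg_derivn.
  have G0' : G^`(g) != 0 by apply: derivn_neq0 => //; rewrite sG.
  by move/eqP; rewrite (negPf (ev_tdeg0_neq0 p tGg G0')).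
have ae := a_min tH H0 HZ.
(* Only a double conic with a = 2 survives. Where [H] vanishes, the second y-derivative of [H * H]
   is twice the square of that of [H], so the derivative of [H], of degree at most 1, vanishes on
   [Z]. *)
have [ea ga] : (e = 2 /\ g = 0)%N by lia.
have : (a <= e.-1)%N; last by lia.
apply: (a_min (tdeg_deriv tH)) => [|p pZ].
  by apply: (@derivn_neq0 _ char0 1); rewrite sH'.
have : mult_ge 3 p (H * H).
  apply: (@mult_ge_unit _ _ _ G); first by apply: ev_tdeg0_neq0; rewrite -?ga.
  by rewrite -expr2 -E; apply: mF.
case=> _ _ [_ _ [+ _ _]]; rewrite !(derivM, derivD) !evD !evM HZ //.
rewrite mul0r mulr0 add0r addr0 -mulr2n => /eqP.
have /pcharf0P natK_eq0 := char0.
by rewrite -mulr_natl mulf_eq0 natK_eq0 /= mulf_eq0 orbb => /eqP.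
Qed.

Lemma triple_points_bezout : (2 <= a)%N -> uniq (map fst Z) ->
  (6 * size Z <= (a + 2) * (a + 1))%N.
Proof.
move=> a2 uZ.
have F0 : F != 0 by rewrite -size_poly_gt0 sF addn3.
have sF' : size F^`() = (a + 2)%N.
  apply/eqP; rewrite eqn_leq; apply/andP; split.
    by have := lt_size_deriv F0; rewrite sF addn3 addn2 ltnS.
  rewrite addn2 ltnNge; apply/negP => h.
  have : F^`(a.+2) != 0 by apply: derivn_neq0 => //; rewrite sF addn3.
  by rewrite derivSn derivn_poly0 ?eqxx.
pose D := \det (sylvester (a + 1) (a + 2) F F^`()).
(* A zero resultant would give [F] and its derivative a common factor of positive y-degree, hence a
   square factor of [F]. *)
have D0 : D != 0.
  have := resultant_eq0 F F^`(); rewrite /resultant.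
  have -> : Sylvester_mx F F^`() =
      sylvester (size F^`()).-1 (size F).-1 F F^`() by [].
  rewrite sF sF' /D !addn1 !addn2 !addn3 /= => ->.
  apply/negP => /(square_factor char0) [G [H [E sH]]].
  exact: (triple_squarefree a2 E sH).
have tF' : tdeg (a + 1) F^`() by have := tdeg_deriv tF; rewrite addn2 addn1.
have := size_det_sylvester tF tF'; rewrite -/D.
have dvdD x : x \in map fst Z -> ('X - x%:P) ^+ 6 %| D.
  case/mapP=> p pZ ->.
  have [_ _ m2] := mF pZ.
  apply: (@dvdp_det_sylvester _ char0 (a + 2) (a + 1) 3 2) => //.
  - by rewrite sF addn3 addn2.
  - by rewrite sF' addn2 addn1.
  - by lia.
  - by lia.
  - exact: mF.
have := prod_XsubC_exp_dvdp uZ dvdD.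
move/(dvdp_leq D0) => h1 h2; have := leq_trans h1 h2.
set Q := \prod_(x <- _) _; have sQ : size Q = (size Z).+1.
  by rewrite size_prod_XsubC size_map.
have : (size (Q ^+ 6)).-1 = (size Z * 6)%N by rewrite size_exp sQ.
by case: (size (Q ^+ 6)); lia.
Qed.

Lemma triple_points_degree : uniq (map fst Z) -> (a <= 1)%N.
Proof.
move=> uZ; rewrite leqNgt; apply/negP => a2.
have h := triple_points_bezout a2 uZ.
have : ('C(a.+1, 2) <= size Z)%N.
  rewrite leqNgt; apply/negP => /exists_vanishing [G [G0 tG ZG]].
  by have := a_min tG G0 ZG; lia.
(* Twice the binomial coefficient is [(a + 1) * a], so 3a(a + 1) is at most (a + 2)(a + 1). *)
have := mul_bin_diag a.+1 1; rewrite bin1 /=.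
by nia.
Qed.

End TriplePoints.

(** * Ternary forms *)

Lemma base_digits_inj N n (a b : 'I_n -> nat) :
  (forall i, (a i < N)%N) -> (forall i, (b i < N)%N) ->
  (\sum_i a i * N ^ i = \sum_i b i * N ^ i)%N -> a =1 b.
Proof.
elim: n a b => [a b _ _ _ []|n IH a b aN bN] //.
have shift (c : 'I_n.+1 -> nat) : (\sum_i c i * N ^ i =
    (\sum_i c (lift ord0 i) * N ^ i) * N + c ord0)%N.
  rewrite big_ord_recl expn0 muln1 addnC big_distrl /=; congr (_ + _)%N.
  by apply: eq_bigr => i _; rewrite /bump /= expnS; lia.
have N0 : (0 < N)%N by apply: leq_trans (aN ord0).
rewrite !shift => E.
have E0 : a ord0 = b ord0.
  by have := congr1 (modn^~ N) E; rewrite !modnMDl !modn_small.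
have ES : (\sum_i a (lift ord0 i) * N ^ i = \sum_i b (lift ord0 i) * N ^ i)%N.
  by move/eqP: E; rewrite E0 eqn_add2r eqn_pmul2r // => /eqP.
move=> i; case: (unliftP ord0 i) => [j|] -> //.
by apply: (IH (fun i => a (lift ord0 i)) (fun i => b (lift ord0 i))).
Qed.

(* Kronecker substitution X_i |-> t^(N^i) keeps the monomials apart. *)
Lemma mpoly_nonroot (K : closedFieldType) n (f : {mpoly K[n]}) :
  f != 0 -> exists x : 'I_n -> K, f.@[x] != 0.
Proof.
move=> f0; pose N := msize f.
pose code (m : 'X_{1..n}) := (\sum_i m i * N ^ i)%N.
have small m i : m \in msupp f -> (m i < N)%N.
  move/msize_mdeg_lt; apply: leq_ltn_trans.
  by rewrite mdegE (bigD1 i) //= leq_addr.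
pose g : {poly K} := \sum_(m <- msupp f) f@_m *: 'X^(code m).
have g0 : g != 0.
  have lf := mlead_supp f0.
  apply: contraTneq (lf) => /polyP /(_ (code (mlead f))).
  rewrite coef0 coef_sum (bigD1_seq (mlead f)) //= coefZ coefXn eqxx mulr1.
  rewrite big_seq_cond big1 ?addr0 => [/eqP|m /andP[mf ne]].
    by rewrite mcoeff_eq0.
  rewrite coefZ coefXn; case: eqP => [E|_]; last by rewrite mulr0.
  case/eqP: ne; apply/mnmP => i; apply/esym; move: i.
  by apply: (base_digits_inj (N := N)) => // i; apply: small.
have [t gt] := closed_nonrootP _ g0.
exists (fun i => t ^+ (N ^ i)%N); suff -> : f.@[fun i => t ^+ (N ^ i)%N] = g.[t] by [].
rewrite mevalE horner_sum; apply: eq_bigr => m _.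
rewrite hornerZ hornerXn expr_sum; congr (_ * _).
by apply: eq_bigr => i _; rewrite -exprM mulnC.
Qed.

Lemma meval_homog (K : fieldType) m (f : {mpoly K[m]}) n (x : 'I_m -> K) l :
  f \is n.-homog -> f.@[fun i => l * x i] = l ^+ n * f.@[x].
Proof.
move/dhomogP=> hf; rewrite !mevalE mulr_sumr big_seq [RHS]big_seq.
apply: eq_bigr => k kf; rewrite mulrCA; congr (_ * _).
have <- : mdeg k = n := hf _ kf.
rewrite mdegE expr_sum -big_split /=.
by apply: eq_bigr => i _; rewrite exprMn.
Qed.

Lemma linear_form_meval (K : fieldType) m (f : {mpoly K[m]}) (x : 'I_m -> K) :
  f \is 1.-homog -> f.@[x] = \sum_i f@_U_(i) * x i.
Proof.
move/dhomogP=> hf.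
have {1}-> : f = \sum_i f@_U_(i) *: 'X_i.
  apply/mpolyP => k; rewrite linear_sum /=.
  have [/existsP[j /eqP ->]|nk] := boolP [exists j, k == U_(j)%MM].
    rewrite (bigD1 j) //= mcoeffZ mcoeffXU eqxx mulr1 big1 ?addr0 // => i ij.
    by rewrite mcoeffZ mcoeffXU (negPf ij) mulr0.
  rewrite big1 => [|i _].
    apply/eqP; rewrite mcoeff_eq0; apply: contra nk => /hf /= k1.
    by rewrite -mdeg_eq1; apply/eqP.
  rewrite mcoeffZ mcoeffX; case: eqP => [E|_]; last by rewrite mulr0.
  by case/existsP: nk; exists i; rewrite E.
rewrite raddf_sum /=; apply: eq_bigr => i _; by rewrite mevalZ mevalXU.
Qed.

Section PointIdeals.
Variable K : fieldType.

Lemma ideal_pow_IP (p : point K) k f : ideal_pow (IP p) k.+1 f -> IP p f.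
Proof.
case=> s [sJ ->] l; rewrite raddf_sum /= big_seq big1 // => x xs.
rewrite mevalM; case: x xs => c /= t xs.
have := sJ _ xs; case/tupleP: t {xs} => g t /= /(_ g (mem_head _ _)) g0.
by rewrite big_cons mevalM g0 mul0r mulr0.
Qed.

Lemma IkZ1_homog (Z : seq (point K)) n (f : {mpoly K[3]}) : f \is n.-homog ->
  (forall p, p \in Z -> f.@[p] = 0) -> IkZ 1 Z f.
Proof.
move=> hf fZ p pZ; exists [:: (1, [tuple f])]; split.
  move=> x; rewrite inE => /eqP -> g; rewrite inE => /eqP -> l.
  by rewrite (meval_homog _ _ hf) fZ // mulr0.
by rewrite big_seq1 big_seq1 mul1r.
Qed.

End PointIdeals.

(** * Passage between ternary forms and affine curves *)

Section AffineChart.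
Variable K : fieldType.
Local Notation P := {poly {poly K}}.
Variables u v o : 'I_3 -> K.

Definition chart_lin (i : 'I_3) : P :=
  ((u i)%:P + (v i)%:P * 'X)%:P + (o i)%:P%:P * 'X.

(* f(u + x v + y o) *)
Definition dehom (f : {mpoly K[3]}) : P := mmap (polyC \o polyC) chart_lin f.

Definition chart (p : K * K) (i : 'I_3) : K := u i + p.1 * v i + p.2 * o i.

Lemma ev_dehom p f : ev p (dehom f) = f.@[chart p].
Proof.
rewrite /ev /dehom /mmap !horner_sum mevalE; apply: eq_bigr => m _.
rewrite /mmap1 !hornerM !hornerC !horner_prod; congr (_ * _).
apply: eq_bigr => i _; rewrite !horner_exp; congr (_ ^+ _).
by rewrite /chart_lin /chart !(hornerE) /=; ring.
Qed.

Let top n (F : P) (c : K) := tdeg n F /\ F`_n = c%:P.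

Let topM m n F G c d : top m F c -> top n G d -> top (m + n) (F * G) (c * d).
Proof.
move=> [tF cF] [tG cG]; split; first exact: tdegM.
by rewrite tdeg_coefM // cF cG polyCM.
Qed.

Let topX m n F c : top m F c -> top (m * n) (F ^+ n) (c ^+ n).
Proof.
move=> tF; elim: n => [|n IH]; last by rewrite mulnS !exprS; apply: topM.
by rewrite muln0 !expr0; split; [exact: tdegC | rewrite coef1].
Qed.

Lemma tdeg_chart_lin i : tdeg 1 (chart_lin i).
Proof.
by move=> [|[|j]] [|[|k]] //= _; rewrite !(coefD, coefMX, coefC, coef0) /=
  ?(coefD, coefMX, coefC, coef0) /= ?(coefD, coefMX, coefC, coef0) /= ?addr0.
Qed.

(** The point [o] is at infinity in the y-direction; if [f] does not vanish there, the y-degree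
    reaches the total degree. *)
Lemma dehom_top n f : f \is n.-homog ->
  tdeg n (dehom f) /\ (dehom f)`_n = (f.@[o])%:P.
Proof.
move/dhomogP=> hf; rewrite /dehom /mmap big_seq mevalE.
have topm m : m \in msupp f ->
    top n ((polyC \o polyC) f@_m * mmap1 chart_lin m) (f@_m * \prod_i o i ^+ m i).
  move=> mf; rewrite -[n]add0n; apply: topM.
    by split; [exact: tdegC | rewrite coefC].
  have <- : mdeg m = n := hf _ mf.
  rewrite mdegE /mmap1.
  apply: (big_rec3 (fun F c d => top d F c)) => [|i F c d _ tF].
    by split; [exact: tdegC | rewrite coef1].
  apply: topM tF; have := @topX 1 (m i) (chart_lin i) (o i); rewrite mul1n.
  apply; split.
    exact: tdeg_chart_lin.
  by rewrite /chart_lin coefD coefC coefMX coefC /= add0r.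
split; first by apply: tdeg_sum => m /topm [].
rewrite coef_sum raddf_sum /= [RHS]big_seq.
by apply: eq_bigr => m /topm [].
Qed.

(** Each of the [k] factors of a generator vanishes at [x], and each contributes one order by
    [mult_ge_mulS]. *)
Lemma mult_ge_dehom k (p : point K) x t f : p =1 (fun i => t * chart x i) -> t != 0 ->
  ideal_pow (IP p) k f -> mult_ge k x (dehom f).
Proof.
move=> Ep t0 [s [sJ ->]]; rewrite /dehom raddf_sum /= big_seq.
apply: (big_ind (mult_ge k x)) => [||y ys]; first exact: mult_ge0.
  by move=> F G; apply: mult_geD.
rewrite rmorphM /=; apply: mult_geMl.
case: y ys => c [l sl] /= /sJ /= {sJ c} Jl.
rewrite -(eqP sl); elim: l Jl {sl} => [|g l IH] Jl //.
rewrite big_cons rmorphM; apply: (@mult_ge_mulS _ (size l)).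
  rewrite -/(dehom g) ev_dehom.
  have := Jl g (mem_head _ _) t^-1; rewrite (meval_eq (v2 := chart x)) // => i.
  by rewrite Ep mulKf.
by apply: IH => h hl; apply: Jl; rewrite inE hl orbT.
Qed.

End AffineChart.

Section Homogenization.
Variable K : fieldType.
Variables T S R : {mpoly K[3]}.

Definition homogenize n (F : {poly {poly K}}) : {mpoly K[3]} :=
  \sum_(i < n.+1) \sum_(j < n.+1 | (i + j <= n)%N)
    F`_i`_j *: (S ^+ j * R ^+ i * T ^+ (n - i - j)).

Lemma meval_homogenize n F w : tdeg n F -> T.@[w] != 0 ->
  (homogenize n F).@[w] = T.@[w] ^+ n * ev (S.@[w] / T.@[w], R.@[w] / T.@[w]) F.
Proof.
move=> tF t0; rewrite /homogenize /ev raddf_sum /=.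
set t := T.@[w] in t0 *; set s := S.@[w]; set r := R.@[w].
have sz i : (size (F`_i)%R <= n.+1)%N.
  by apply/leq_sizeP => j hj; apply: tF; lia.
rewrite (@horner_coef_wide _ n.+1 F); last first.
  by apply/leq_sizeP => j hj; apply: (tdeg_coef0 tF).
rewrite horner_sum mulr_sumr; apply: eq_bigr => i _.
rewrite -polyC_exp hornerM hornerC (horner_coef_wide _ (sz i)) mulr_suml.
rewrite mulr_sumr raddf_sum /= big_mkcond; apply: eq_bigr => j _ /=.
case: leqP => ij; last by rewrite tF // !mul0r mulr0.
rewrite mevalZ !mevalM !rmorphXn /= -/t -/s -/r.
have -> : t ^+ n = t ^+ (n - i - j) * t ^+ i * t ^+ j.
  by rewrite -!exprD; congr (_ ^+ _); lia.
rewrite !expr_div_n.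
by field; rewrite !expf_neq0.
Qed.

Hypotheses (hT : T \is 1.-homog) (hS : S \is 1.-homog) (hR : R \is 1.-homog).

Lemma homogenize_homog n F : homogenize n F \is n.-homog.
Proof.
apply: rpred_sum => i _; apply: rpred_sum => j ij; apply: rpredZ.
have := dhomogM (dhomogM (dhomogMn j hS) (dhomogMn i hR)) (dhomogMn (n - i - j) hT).
by have -> : (1 * j + 1 * i + 1 * (n - i - j) = n)%N by lia.
Qed.

End Homogenization.

Section Det3.
Variable K : fieldType.
Implicit Types p q r u v o w : 'I_3 -> K.

Let i0 : 'I_3 := @Ordinal 3 0 isT.
Let i1 : 'I_3 := @Ordinal 3 1 isT.
Let i2 : 'I_3 := @Ordinal 3 2 isT.

Let ord3 (Q : 'I_3 -> Prop) : Q i0 -> Q i1 -> Q i2 -> forall i, Q i.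
Proof.
move=> q0 q1 q2 [[|[|[|//]]] hi].
- by rewrite (_ : Ordinal hi = i0) //; apply: val_inj.
- by rewrite (_ : Ordinal hi = i1) //; apply: val_inj.
- by rewrite (_ : Ordinal hi = i2) //; apply: val_inj.
Qed.

Definition det3 p q r : K :=
  (p i1 * q i2 - p i2 * q i1) * r i0 + (p i2 * q i0 - p i0 * q i2) * r i1
  + (p i0 * q i1 - p i1 * q i0) * r i2.

Definition det_form p q : {mpoly K[3]} :=
  (p i1 * q i2 - p i2 * q i1) *: 'X_i0 + (p i2 * q i0 - p i0 * q i2) *: 'X_i1
  + (p i0 * q i1 - p i1 * q i0) *: 'X_i2.

Lemma meval_det_form p q r : (det_form p q).@[r] = det3 p q r.
Proof. by rewrite /det_form !mevalD !mevalZ !mevalXU. Qed.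

Lemma det_form_homog p q : det_form p q \is 1.-homog.
Proof. by rewrite !rpredD // rpredZ // dhomogX /= mdeg1. Qed.

Lemma det_form_eq0 p q : det_form p q = 0 -> (exists i, q i != 0) ->
  exists l, p =1 (fun i => l * q i).
Proof.
move=> E [i qi0].
have D r : det3 p q r = 0 by rewrite -meval_det_form E meval0.
have E0 := D (fun i => (i == i0)%:R); have E1 := D (fun i => (i == i1)%:R).
have E2 := D (fun i => (i == i2)%:R).
rewrite /det3 /= !mulr0 !mulr1 ?addr0 ?add0r in E0 E1 E2.
exists (p i / q i); move: i qi0.
move/eqP: E0; rewrite subr_eq0 => /eqP E0.
move/eqP: E1; rewrite subr_eq0 => /eqP E1.
move/eqP: E2; rewrite subr_eq0 => /eqP E2.
have cl x y (a c : K) : c != 0 -> x * c = a * y -> x = a / c * y.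
  by move=> c0 h; rewrite mulrAC -h mulfK.
by apply: ord3 => q0; apply: ord3; apply: cl.
Qed.

Variables u v o : 'I_3 -> K.
Hypothesis D0 : det3 u v o != 0.

Let D := det3 u v o.
(** By Cramer's rule, the basis of linear forms dual to [u], [v], [o]. *)
Definition chart_forms :=
  (D^-1 *: det_form v o, D^-1 *: det_form o u, D^-1 *: det_form u v).
Let T := chart_forms.1.1.
Let S := chart_forms.1.2.
Let R := chart_forms.2.

Lemma meval_chart x :
  [/\ T.@[chart u v o x] = 1, S.@[chart u v o x] = x.1 & R.@[chart u v o x] = x.2].
Proof.
rewrite /T /S /R /= !mevalZ !meval_det_form /D.
by split; move: D0; rewrite /det3 /chart => D0'; field.
Qed.

Definition affine_coord p : K * K := (S.@[p] / T.@[p], R.@[p] / T.@[p]).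

Lemma chart_affine_coord p : det3 v o p != 0 ->
  p =1 (fun i => T.@[p] * chart u v o (affine_coord p) i).
Proof.
rewrite /affine_coord /T /S /R /= !mevalZ !meval_det_form /D => Dp.
by apply: ord3; move: D0 Dp; rewrite /chart /= /det3 => D0' Dp; field; apply/andP.
Qed.

(* The Pluecker relations identify the 2x2 minors of the chart coordinates of
   p and q with det(p, q, o) and det(p, q, v). *)
Lemma affine_coord_inj p q : det3 v o p != 0 -> det3 v o q != 0 ->
  det_form p q = 0 \/ det3 p q o != 0 ->
  (affine_coord p).1 = (affine_coord q).1 -> affine_coord p = affine_coord q.
Proof.
rewrite /affine_coord /T /S /R /= !mevalZ !meval_det_form -/D => Dp Dq Dpq.
have DV : D^-1 != 0 by rewrite invr_eq0.
rewrite -!mulf_div !divff // !mul1r => /eqP E.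
congr pair; rewrite ?(eqP E) //; apply/eqP; move: E.
rewrite !eqr_div // -subr_eq0 -[X in _ -> is_true X]subr_eq0.
have -> : det3 o u p * det3 v o q - det3 o u q * det3 v o p =
    - (det3 p q o * D) by rewrite /D /det3; ring.
have -> : det3 u v p * det3 v o q - det3 u v q * det3 v o p =
    det3 p q v * D by rewrite /D /det3; ring.
rewrite oppr_eq0 !mulf_eq0 (negPf D0) !orbF => E.
case: Dpq => [Epq|]; last by rewrite E.
by rewrite -meval_det_form Epq meval0.
Qed.

End Det3.

(** * Generic choices and conclusion *)

Lemma generic_point (K : closedFieldType) n (s : seq {mpoly K[n]}) :
  exists x : 'I_n -> K, forall f, f \in s -> f != 0 -> f.@[x] != 0.
Proof.
have [|x] := @mpoly_nonroot K n (\prod_(f <- s | f != 0) f).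
  by rewrite prodf_seq_neq0; apply/allP => f _; apply/implyP.
rewrite rmorph_prod /= prodf_seq_neq0 => /allP h.
by exists x => f fs f0; have /implyP := h f fs; apply.
Qed.

Lemma exists_ev_neq0 (K : closedFieldType) (F : {poly {poly K}}) :
  F != 0 -> exists p, ev p F != 0.
Proof.
rewrite -lead_coef_eq0 => /closed_nonrootP [x Fx].
have : map_poly (horner_eval x) F != 0.
  apply: contraNneq Fx => /polyP /(_ (size F).-1); rewrite coef_map coef0 /=.
  by move=> h; apply/eqP.
case/closed_nonrootP => y Fy; exists (x, y); apply: contra Fy => /eqP Fxy.
apply/eqP; rewrite -[y](hornerC y x) -/(horner_eval x y%:P) horner_map /=.
exact: Fxy.
Qed.

Lemma linear_collinear (K : fieldType) (Z : seq (point K)) f :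
  f != 0 -> f \is 1.-homog -> (forall p, p \in Z -> f.@[p] = 0) -> collinear Z.
Proof.
move=> f0 hf fZ; exists (fun i => f@_U_(i)); split; last first.
  by move=> p pZ; rewrite -(linear_form_meval _ hf); apply: fZ.
have lf := mlead_supp f0; move/dhomogP: hf => /(_ _ lf) /= d1.
have : mdeg (mlead f) == 1%N by apply/eqP.
rewrite mdeg_eq1 => /existsP [i /eqP E]; exists i.
by rewrite -E -mcoeff_msupp.
Qed.

Theorem theorem3p1 (K : closedFieldType) (char0 : [pchar K] =i pred0)
  (Z : seq (point K)) (Znz : forall p, p \in Z -> exists i, p i != 0)
  (k : nat) (hk : (3 <= k)%N) (a1 ak : nat) :
  is_alpha (IkZ 1 Z) a1 -> is_alpha (IkZ k Z) ak ->
  ak = (a1 + (k - 1))%N ->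
  collinear Z.
Proof.
move=> [[f1 [f10 hf1 If1]] min1] [[f [f0 hf If]] _] Eak.
have [Z0|[p0 p0Z]] : Z = [::] \/ exists p, p \in Z.
- by case: (Z) => [|p Z']; [left | right; exists p; rewrite mem_head].
- rewrite Z0; exists (fun=> 1); split; last by [].
  by exists ord0; rewrite oner_eq0.
have f1Z p : p \in Z -> f1.@[p] = 0.
  move=> /If1 /ideal_pow_IP /(_ 1) <-.
  by apply: meval_eq => i; rewrite mul1r.
(* A form of degree 1 gives the line; one of degree 0 is a nonzero constant and cannot vanish at
   [p0]. *)
suff : (a1 <= 1)%N.
  case: a1 hf1 {min1 Eak} => [|[|//]] hf1 _; last first.
    exact: linear_collinear f10 hf1 f1Z.
  have [x /eqP[]] := mpoly_nonroot f10.
  have : f1.@[fun i => 0 * x i] = f1.@[fun i => 0 * p0 i].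
    by apply: meval_eq => i; rewrite !mul0r.
  by rewrite !(meval_homog _ _ hf1) !expr0 !mul1r f1Z.
have fZ p l : p \in Z -> f.@[fun i => l * p i] = 0.
  by move=> /If; rewrite -(subnKC hk) => /ideal_pow_IP; apply.
(* Off the curve [f], so that the y-degree is full, and off every line joining two points of [Z], so
   that projection from [o] separates them. *)
have [o ho] := generic_point
  (f :: [seq det_form p q | p : point K <- Z, q : point K <- Z]).
have fo : f.@[o] != 0 by apply: ho; rewrite // mem_head.
have pqo (p q : point K) : p \in Z -> q \in Z -> det_form p q = 0 \/ det3 p q o != 0.
  move=> pZ qZ; have [|pq0] := eqVneq (det_form p q) 0; [by left | right].
  rewrite -meval_det_form; apply: ho => //; rewrite inE; apply/orP; right.
  by apply/allpairsP; exists (p, q).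
(* The line at infinity, through [v] and [o], must miss [Z]. The forms are nonzero: [f] vanishes on
   all multiples of a point of [Z], but not at [o]. *)
have [v hv] := generic_point [seq det_form o p | p : point K <- Z].
have vop (p : point K) : p \in Z -> det3 v o p != 0.
  move=> pZ; have -> : det3 v o p = det3 o p v by rewrite /det3; ring.
  rewrite -meval_det_form; apply: hv; first by apply/mapP; exists p.
  apply: contraNneq fo => /det_form_eq0 /(_ (Znz p pZ)) [l El].
  by rewrite (meval_eq _ El) fZ.
have D0 : det3 p0 v o != 0.
  by have := vop p0 p0Z; congr (_ != 0); rewrite /det3; ring.
pose aff (p : point K) := affine_coord p0 v o p.
have T0 (p : point K) : p \in Z -> (chart_forms p0 v o).1.1.@[p] != 0.
  by move=> pZ; rewrite mevalZ meval_det_form mulf_neq0 ?invr_eq0 // vop.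
(* The degree drops to ak - (k - 3) = a1 + 2, and multiplicity 3 remains on [Z]. *)
pose F := (dehom p0 v o f)^`(k - 3).
have [tf cf] := dehom_top p0 v o hf.
have tF : tdeg (a1 + 2) F.
  have := tdeg_derivn (m := k - 3) tf.
  by have -> : (ak - (k - 3) = a1 + 2)%N by lia.
have sF : size F = (a1 + 3)%N.
  rewrite addn3 -addn2; apply/eqP; rewrite eqn_leq; apply/andP; split.
    by apply/leq_sizeP => j; apply: (tdeg_coef0 tF).
  rewrite ltnNge; apply/negP => /leq_sizeP /(_ _ (leqnn _)).
  rewrite coef_derivn; have -> : (k - 3 + (a1 + 2) = ak)%N by lia.
  rewrite cf -scaler_nat => /eqP; rewrite scaler_eq0 polyC_eq0 (negPf fo) orbF.
  have /pcharf0P -> := char0.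
  by rewrite -leqn0 leqNgt ffact_gt0; lia.
(* Several entries of [Z] may represent the same projective point, hence [undup]. *)
apply: (@triple_points_degree K char0 (undup (map aff Z)) a1 _ F tF sF).
- move=> G n tG G0 GZ; apply: min1.
  have hT : (chart_forms p0 v o).1.1 \is 1.-homog by rewrite rpredZ ?det_form_homog.
  have hS : (chart_forms p0 v o).1.2 \is 1.-homog by rewrite rpredZ ?det_form_homog.
  have hR : (chart_forms p0 v o).2 \is 1.-homog by rewrite rpredZ ?det_form_homog.
  have hG := homogenize_homog hT hS hR n G.
  eexists; split; last 1 first.
  + apply: (IkZ1_homog hG) => p pZ.
    rewrite meval_homogenize ?T0 // -/(affine_coord _ _ _ _) GZ ?mulr0 //.
    by rewrite mem_undup; apply/mapP; exists p.
  (* Evaluated on the chart, where [T] is 1, the homogenization gives back [G]. *)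
  + have [x Gx] := exists_ev_neq0 G0; apply: contraNneq Gx => hG0.
    have [Tx Sx Rx] := meval_chart D0 x.
    have := @meval_homogenize K (chart_forms p0 v o).1.1 (chart_forms p0 v o).1.2
      (chart_forms p0 v o).2 n G (chart p0 v o x) tG.
    rewrite hG0 meval0 Tx Sx Rx oner_eq0 expr1n mul1r !divr1.
    by rewrite -surjective_pairing => /(_ isT) <-.
  + exact: hG.
- move=> x; rewrite mem_undup => /mapP [p pZ ->].
  apply: mult_ge_derivn; rewrite subnK //.
  apply: mult_ge_dehom (chart_affine_coord D0 (vop p pZ)) (T0 p pZ) _.
  exact: If.
- rewrite map_inj_in_uniq ?undup_uniq // => x y; rewrite !mem_undup.
  move=> /mapP [p pZ ->] /mapP [q qZ ->]; apply: affine_coord_inj => //.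
  + exact: vop.
  + exact: vop.
  + exact: pqo.
Qed.
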